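(* Let $T\subseteq\Pi_n$ be a lower set and suppose that $|X_i|\geq n$ for all $1\le i\le n$. Then a partition $\sigma\in\Pi_n$ satisfies $T[P_\sigma]=0$ for all probability measures $P\in\mathcal{M}(\mathbb{X}_n)$ if and only if $\sigma\in T\setminus\{\hat{\mathbf{1}}_n\}$.
   Context: $\Pi_n$ denotes the set of all partitions of $\{1,\dots,n\}$ into nonempty disjoint blocks, ordered by refinement: $\pi\le\sigma$ iff every block of $\pi$ is contained in a block of $\sigma$. $\hat{\mathbf{0}}_n$ is the partition into singletons and $\hat{\mathbf{1}}_n$ the one-block partition. A subset $T\subseteq\Pi_n$ is called a lower set if it contains $\hat{\mathbf 0}_n$ and $\hat{\mathbf 1}_n$ and, for every $w\in T\setminus\{\hat{\mathbf 1}_n\}$ and $z\in\Pi_n$ with $z\le w$, one has $z\in T$. Such $T$ carries the induced order, and $\mu$ denotes the M\''obius function of the poset $T$: $\mu(x,x)=1$, $\mu(x,y)=-\sum_{z\in T,\,x\le z<y}\mu(x,z)$ for $x<y$ in $T$, and $\mu(x,y)=0$ otherwise. $X_1,\dots,X_n$ are nonempty sets, $\mathbb{X}_n=X_1\times\cdots\times X_n$, and $\mathcal{M}(\mathbb{X}_n)$ is the vector space of discrete signed measures on $\mathbb{X}_n$ (finite real linear combinations of Dirac measures). For a probability measure $P\in\mathcal{M}(\mathbb{X}_n)$ and nonempty $F\subseteq\{1,\dots,n\}$, $P_F$ is the marginal of $P$ on $\prod_{i\in F}X_i$; for $\pi=(F_1,\dots,F_\ell)\in\Pi_n$, $P_\pi:=P_{F_1}\times\cdots\times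 P_{F_\ell}$, viewed as a measure on $\mathbb{X}_n$. The interaction is the signed measure $T[P]:=\sum_{\pi\in T}\mu(\pi,\hat{\mathbf{1}}_n)P_\pi$. *)

(* Defs.v *)
From HB Require Import structures.
From mathcomp Require Import all_classical all_reals numfun.
From mathcomp Require Import all_boot all_order all_algebra.

Set Implicit Arguments.
Unset Strict Implicit.
Unset Printing Implicit Defensive.

Import Order.TTheory GRing.Theory Num.Theory.

Local Open Scope ring_scope.

Section Mobius.
Context {disp : Order.disp_t} {V : finPOrderType disp}.
Implicit Types (T : {set V}) (x y z : V).

(* The recursion descends along the order, so [k] is only fuel: any
   [k > #|[set z | z < y]|] gives the same value, see [mobius_lt]. *)
Fixpoint mobius_rec T (k : nat) x y : int :=
  if k isn't k'.+1 then 0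
  else if x == y then 1
  else if (x < y)%O then
    - \sum_(z in T | (x <= z)%O && (z < y)%O) mobius_rec T k' x z
  else 0.

Definition mobius T x y : int :=
  if (x \in T) && (y \in T) then mobius_rec T #|V| x y else 0.

Lemma mobius_rec_fuel T k k' x y :
  (#|[set z | (z < y)%O]| < k)%N -> (#|[set z | (z < y)%O]| < k')%N ->
  mobius_rec T k x y = mobius_rec T k' x y.
Proof.
elim: k k' y => [//|k IH] [//|k'] y hk hk' /=.
case: eqP => // _; case: ifP => // _; congr (- _).
apply: eq_bigr => z /andP[_ /andP[_ zy]].
have lt_card : (#|[set t | (t < z)%O]| < #|[set t | (t < y)%O]|)%N.
  apply: proper_card; apply/properP; split.
    by apply/subsetP => t; rewrite !inE => /lt_trans; apply.
  by exists z; rewrite !inE ?zy ?ltxx.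
by apply: IH; apply: leq_trans lt_card _.
Qed.

Lemma card_below_lt y : (#|[set z | (z < y)%O]| < #|V|)%N.
Proof.
rewrite -cardsT; apply: proper_card; apply/properP; split; first exact: subsetT.
by exists y; rewrite !inE ?ltxx.
Qed.

Lemma mobius_refl T x : x \in T -> mobius T x x = 1.
Proof.
move=> xT; rewrite /mobius xT /=; have := card_below_lt x.
by case: #|V| => [//|k] _ /=; rewrite eqxx.
Qed.

Lemma mobius_lt T x y : x \in T -> y \in T -> (x < y)%O ->
  mobius T x y = - \sum_(z in T | (x <= z)%O && (z < y)%O) mobius T x z.
Proof.
move=> xT yT xy; rewrite {1}/mobius xT yT /=.
rewrite (@mobius_rec_fuel _ _ #|V|.+1) ?card_below_lt //; last first.
  exact: leqW (card_below_lt y).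
rewrite /= (negbTE (negbT (lt_eqF xy))) xy; congr (- _).
by apply: eq_bigr => z /andP[zT _]; rewrite /mobius xT zT.
Qed.

Lemma mobius_nle T x y : ~~ (x <= y)%O -> mobius T x y = 0.
Proof.
move=> nxy; rewrite /mobius; case: ifP => // _.
case: #|V| => [//|k] /=; case: eqP => [exy|_]; first by rewrite exy lexx in nxy.
by case: ifP => // /ltW xy; rewrite xy in nxy.
Qed.

End Mobius.

Record part (n : nat) := Part {
  blocks :> {set {set 'I_n}};
  part_proof : partition blocks [set: 'I_n] }.

HB.instance Definition _ n := [isSub for @blocks n].
HB.instance Definition _ n := [Finite of part n by <:].

Definition refines n (p q : part n) : bool :=
  [forall B in blocks p, exists C in blocks q, B \subset C].

Section RefinementOrder.
Variable n : nat.
Implicit Types p q r : part n.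

Lemma refinesP p q :
  reflect (forall B, B \in blocks p -> exists2 C, C \in blocks q & B \subset C)
          (refines p q).
Proof.
apply: (iffP forall_inP) => h B /h.
  by move=> /exists_inP.
by move=> ?; apply/exists_inP.
Qed.

Lemma refines_refl : reflexive (@refines n).
Proof. by move=> p; apply/refinesP => B pB; exists B. Qed.

Lemma refines_trans : transitive (@refines n).
Proof.
move=> q p r /refinesP pq /refinesP qr; apply/refinesP => B /pq[C /qr[D rD CD] BC].
by exists D => //; apply: subset_trans CD.
Qed.

Lemma refines_sub p q : refines p q -> refines q p -> blocks p \subset blocks q.
Proof.
move=> /refinesP pq /refinesP qp; apply/subsetP => B pB.
have [C qC BC] := pq B pB; have [D pD CD] := qp C qC.
have /and3P[_ trivp p0] := part_proof p.
have /set0Pn[i Bi] : B != set0 by apply: contraNneq p0 => <-.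
have Di : i \in D by apply: (subsetP CD); apply: (subsetP BC).
have eBD : B = D by rewrite -(def_pblock trivp pB Bi) (def_pblock trivp pD Di).
by suff -> : B = C by []; apply/eqP; rewrite eqEsubset BC eBD CD.
Qed.

Lemma refines_anti : antisymmetric (@refines n).
Proof.
move=> p q /andP[pq qp]; apply: val_inj; apply/eqP.
by rewrite eqEsubset !refines_sub.
Qed.

End RefinementOrder.

Fact part_display : Order.disp_t. Proof. exact: Order.Disp tt tt. Qed.

HB.instance Definition _ n := Order.Le_isPOrder.Build part_display (part n)
  (@refines_refl n) (@refines_anti n) (@refines_trans n).

Lemma zero_part_proof n :
  partition [set [set i] | i : 'I_n] [set: 'I_n].
Proof.
apply/and3P; split.
- apply/eqP/setP => i; rewrite inE; apply/bigcupP.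
  by exists [set i]; rewrite ?set11 // imset_f.
- apply/trivIsetP => _ _ /imsetP[i _ ->] /imsetP[j _ ->] ij.
  rewrite -setI_eq0; apply/eqP/setP => k; rewrite !inE.
  by apply/andP => -[/eqP ki /eqP kj]; rewrite -ki -kj eqxx in ij.
- by apply/imsetP => -[i _ /setP/(_ i)]; rewrite !inE eqxx.
Qed.

Definition zero_part n : part n := Part (zero_part_proof n).

(* Removing [set0] only matters for [n = 0], where there is no one-block
   partition; for [0 < n] see [one_partE]. *)
Lemma one_part_proof n : partition ([set [set: 'I_n]] :\ set0) [set: 'I_n].
Proof.
apply/and3P; split.
- apply/eqP/setP => i; rewrite inE; apply/bigcupP.
  exists [set: 'I_n]; rewrite !inE ?eqxx ?andbT //.
  by apply/set0Pn; exists i; rewrite inE.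
- apply/trivIsetP => A B; rewrite !inE.
  by move=> /andP[_ /eqP->] /andP[_ /eqP->]; rewrite eqxx.
- by rewrite !inE eqxx.
Qed.

Definition one_part n : part n := Part (one_part_proof n).

Lemma one_partE n : (0 < n)%N -> blocks (one_part n) = [set [set: 'I_n]].
Proof.
case: n => // n _; apply/setP => B; rewrite !inE.
case: (B =P [set: 'I_n.+1]) => [->|]; rewrite ?andbF ?andbT //.
by apply/set0Pn; exists ord0; rewrite inE.
Qed.

Definition lower_set n (T : {set part n}) : Prop :=
  [/\ zero_part n \in T, one_part n \in T &
      forall w z : part n,
        w \in T :\ one_part n -> (z <= w)%O -> z \in T].

(* Measures are real-valued functions on all subsets of the space. *)
Definition discrete_measure (R : realType) (Y : Type) (m : set Y -> R) : Prop :=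
  exists (k : nat) (c : 'I_k -> R) (x : 'I_k -> Y),
    forall A : set Y, m A = \sum_(i < k) c i * \1_A (x i).

Definition discrete_probability (R : realType) (Y : Type) (m : set Y -> R) :
    Prop :=
  [/\ discrete_measure m, forall A, 0 <= m A & m [set: Y]%classic = 1].

Definition restr n (X : 'I_n -> choiceType) (F : {set 'I_n})
    (x : forall i, X i) : forall i : {i | i \in F}, X (val i) :=
  fun i => x (val i).
Arguments restr {n X} F x i.

Definition marginal (R : realType) n (X : 'I_n -> choiceType)
    (P : set (forall i, X i) -> R) (F : {set 'I_n}) :
    set (forall i : {i | i \in F}, X (val i)) -> R :=
  fun B => P (restr F @^-1` B)%classic.
Arguments marginal {R n X} P F B.

(* The product of discrete measures is the one giving each point [x] the product
   of the masses of its projections. For discrete [P] only finitely many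
   points have nonzero mass, so the [\sum] is a genuine finite sum. *)
Definition product_of_marginals (R : realType) n (X : 'I_n -> choiceType)
    (pi : part n) (P : set (forall i, X i) -> R) :
    set (forall i, X i) -> R :=
  fun A => \sum_(x \in A)
    \prod_(F in blocks pi) marginal P F [set restr F x]%classic.

Definition interaction (R : realType) n (X : 'I_n -> choiceType)
    (T : {set part n}) (P : set (forall i, X i) -> R) :
    set (forall i, X i) -> R :=
  fun A => \sum_(pi in T)
    (mobius T pi (one_part n))%:~R * product_of_marginals pi P A.

(* Main.v *)
Require Import Defs.
From HB Require Import structures.
From mathcomp Require Import all_classical all_reals numfun.
From mathcomp Require Import all_boot all_order all_algebra.
From mathcomp Require Import lra.

(** Write [P] as a finite mixture of Dirac masses. Then [P_sigma] is again such
    a mixture: draw one independent atom for each block of [sigma] and read the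
    coordinates of a block off the atom drawn for it. Iterating,
    [(P_sigma)_pi = P_(pi meet sigma)] ([product_product]), so that
    [T[P_sigma] = \sum_(pi in T) mu(pi, 1) P_(pi meet sigma)].

    If [sigma] is in [T] and is not the top, everything below [sigma] is in [T],
    and Weisner's theorem makes the coefficient of each [P_tau] vanish
    ([mobius_sum_meet]).

    Otherwise the only [pi >= sigma] in [T] is the top: any other one would
    force [sigma] into [T] and below the top. Hence [P_sigma] occurs with
    coefficient 1, and all other terms [P_tau] have [tau < sigma]. To see
    that they cannot cancel it, embed ['I_n] into every [X i], let [P] be carried
    by the diagonal, and evaluate at the point whose coordinates are constant
    on each block of [sigma], with different values on different blocks. If these
    values all have mass [t], then [P_tau] gives the point mass [t ^+ #|tau|],
    so the sum is [t ^+ #|sigma|] plus terms of higher order in [t], and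
    it is nonzero for small [t] ([mobius_sum_neq0]). The mass not used by the
    blocks goes to an index outside the values taken; there is one unless
    [sigma] is the partition into singletons, and then no other term occurs. *)

Set Implicit Arguments.
Unset Strict Implicit.
Unset Printing Implicit Defensive.

Import Order.TTheory GRing.Theory Num.Theory.

Local Open Scope ring_scope.

(** * Moebius sums and Weisner's theorem *)

Section MobiusInversion.
Context {disp : Order.disp_t} {V : finPOrderType disp}.
Implicit Types (T : {set V}) (x y z : V).

Lemma mobius_suml T x y : x \in T -> y \in T ->
  \sum_(z in T | (z <= y)%O) mobius T x z = (x == y)%:R.
Proof.
move=> xT yT; have [->|xy] := eqVneq x y.
  rewrite (bigD1 y) ?yT ?lexx //= mobius_refl // big1 ?addr0 // => z.
  move=> /andP[/andP[_ zy] nzy]; apply: mobius_nle.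
  by apply: contra nzy => yz; rewrite eq_le zy.
have [lexy|nlexy] := boolP (x <= y)%O; last first.
  rewrite big1 // => z /andP[_ zy]; apply: mobius_nle.
  by apply: contra nlexy => /le_trans; apply.
rewrite (bigD1 y) ?yT ?lexx //= [mobius T x y]mobius_lt ?lt_neqAle ?xy //.
rewrite addrC (bigID (fun z => (x <= z)%O)) /= [X in _ + X + _]big1; last first.
  by move=> z /andP[_ ?]; apply: mobius_nle.
rewrite addr0; apply/eqP; rewrite subr_eq0; apply/eqP; apply: eq_bigl => z.
by rewrite lt_neqAle; case: (z \in T) (x <= z)%O (z != y) (z <= y)%O => [] [] [] [].
Qed.

(** The Moebius function is defined as a left inverse of the zeta matrix of [T];
    a left inverse of a square matrix is also a right inverse. *)
Lemma mobius_sumr T x y : x \in T -> y \in T ->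
  \sum_(z in T | (x <= z)%O) mobius T z y = (x == y)%:R.
Proof.
move=> xT yT.
pose M : 'M[int]_#|T| := \matrix_(i, j) mobius T (enum_val i) (enum_val j).
pose Z : 'M[int]_#|T| := \matrix_(i, j) (enum_val i <= enum_val j)%O%:R.
have MZ : M *m Z = 1%:M.
  apply/matrixP => i j; rewrite !mxE -(inj_eq enum_val_inj).
  rewrite -(@mobius_suml T) ?enum_valP // big_mkcondr [RHS]big_enum_val /=.
  by apply: eq_bigr => k _; rewrite !mxE mulr_natr; case: (_ <= _)%O.
have /matrixP/(_ (enum_rank_in xT x) (enum_rank_in xT y)) := mulmx1C MZ.
rewrite !mxE -(inj_eq enum_val_inj) !enum_rankK_in // => <-.
rewrite [LHS]big_mkcondr [LHS]big_enum_val /=; apply: eq_bigr => k _.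
by rewrite !mxE !enum_rankK_in // mulr_natl; case: (_ <= _)%O.
Qed.

(** Weisner's theorem. Here [m] plays the meet with [s]. For [t <= s] the fibres
    over the [u >= t] together cover the interval above [t], whose Moebius sum
    is zero as [t] is not the top; downward induction on [t] kills all the
    fibres other than the one over [t]. *)
Lemma mobius_meet_fiber T (top s t : V) (m : V -> V) :
  top \in T -> (s < top)%O ->
  (forall z, (z <= s)%O -> z \in T) ->
  (forall x z, (z <= m x)%O = (z <= x)%O && (z <= s)%O) ->
  \sum_(x in T | m x == t) mobius T x top = 0.
Proof.
move=> topT ltst sT mP.
have [k] := ubnP #|[set z | (t < z)%O]|; elim: k t => // k IH t.
rewrite ltnS => tk.
have [ts|nts] := boolP (t <= s)%O; last first.
  rewrite big_pred0 // => x; apply/negP => /andP[_ /eqP mxt].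
  by move: (mP x t); rewrite mxt lexx (negbTE nts) andbF.
have := mobius_sumr (sT _ ts) topT.
have -> : (t == top) = false by rewrite lt_eqF // (le_lt_trans ts).
rewrite (partition_big m (fun u => (t <= u)%O)); last first.
  by move=> x /andP[_ tx]; rewrite mP tx.
rewrite (bigD1 t) //= [X in _ + X]big1 ?addr0; last first.
  move=> u /andP[tu nut]; have ltu : (t < u)%O by rewrite lt_def nut.
  rewrite -[RHS](IH u); last first.
    apply: leq_trans tk; apply: proper_card; apply/properP; split.
      by apply/subsetP => v; rewrite !inE; apply: lt_trans.
    by exists u; rewrite !inE ?ltxx.
  apply: eq_bigl => x; case: eqP => [mxu|]; rewrite ?andbF // !andbT.
  by move: (mP x t); rewrite mxu tu ts andbT => <-; rewrite andbT.
move=> sum0; rewrite -[RHS]sum0; apply: eq_bigl => x.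
case: eqP => [mxt|]; rewrite ?andbF // !andbT.
by move: (mP x t); rewrite mxt lexx ts andbT => <-; rewrite andbT.
Qed.

Lemma mobius_sum_meet (R : pzRingType) T (top s : V) (m : V -> V) (f : V -> R) :
  top \in T -> (s < top)%O ->
  (forall z, (z <= s)%O -> z \in T) ->
  (forall x z, (z <= m x)%O = (z <= x)%O && (z <= s)%O) ->
  \sum_(x in T) (mobius T x top)%:~R * f (m x) = 0.
Proof.
move=> topT ltst sT mP.
rewrite (partition_big m predT) //= big1 // => t _.
rewrite (eq_bigr (fun x => (mobius T x top)%:~R * f t)); last first.
  by move=> x /andP[_ /eqP->].
by rewrite -mulr_suml -rmorph_sum (@mobius_meet_fiber T top s) // mul0r.
Qed.

End MobiusInversion.

(** * Meets of partitions *)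

Section Meet.
Variable n : nat.
Implicit Types (p q r : part n) (i j : 'I_n) (F G : {set 'I_n}).

Lemma part_trivIset p : trivIset p.
Proof. by have /and3P[] := part_proof p. Qed.

Lemma part_block_neq0 p F : F \in blocks p -> F != set0.
Proof. by have /and3P[_ _ p0] := part_proof p; apply: contraTneq => ->. Qed.

Lemma mem_cover_part p i : i \in cover p.
Proof. by have /and3P[/eqP-> _ _] := part_proof p; rewrite inE. Qed.

Lemma mem_pblock_part p i : i \in pblock p i.
Proof. by rewrite mem_pblock mem_cover_part. Qed.

Lemma pblock_part p i : pblock p i \in blocks p.
Proof. by rewrite pblock_mem ?mem_cover_part. Qed.

Lemma mem_partE p F i : F \in blocks p -> (pblock p i == F) = (i \in F).
Proof.
move=> pF; apply/eqP/idP => [<-|]; first exact: mem_pblock_part.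
exact: def_pblock (part_trivIset p) pF.
Qed.

Lemma blockP p F : F \in blocks p -> exists i, F = pblock p i.
Proof.
move=> pF; have /set0Pn[i Fi] := part_block_neq0 pF.
by exists i; apply/esym/eqP; rewrite mem_partE.
Qed.

Lemma part_leP p q :
  reflect (forall i, pblock p i \subset pblock q i) (p <= q)%O.
Proof.
apply: (iffP (refinesP p q)) => [pq i|pq F pF].
  have [G qG pG] := pq _ (pblock_part p i).
  suff -> : pblock q i = G by [].
  by apply/eqP; rewrite mem_partE // (subsetP pG) ?mem_pblock_part.
by have [i ->] := blockP pF; exists (pblock q i); rewrite ?pblock_part.
Qed.

Lemma le_one_part p : (0 < n)%N -> (p <= one_part n)%O.
Proof.
move=> n0; apply/refinesP => F _; exists [set: 'I_n]; last exact: subsetT.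
by rewrite one_partE ?inE.
Qed.

Definition meet_part p q : part n :=
  Part (preim_partitionP (fun i => (pblock p i, pblock q i)) [set: 'I_n]).

Lemma pblock_meet p q i : pblock (meet_part p q) i = pblock p i :&: pblock q i.
Proof.
apply/setP => j; rewrite inE /= /preim_partition pblock_equivalence_partition ?inE //.
  by rewrite xpair_eqE !eq_pblock ?part_trivIset ?mem_cover_part.
by split=> // /eqP->.
Qed.

Lemma le_meet_part p q r : (r <= meet_part p q)%O = (r <= p)%O && (r <= q)%O.
Proof.
apply/part_leP/andP => [h|[/part_leP rp /part_leP rq] i].
  by split; apply/part_leP => i; have := h i; rewrite pblock_meet subsetI => /andP[].
by rewrite pblock_meet subsetI rp rq.
Qed.

Lemma meet_part_lel p q : (meet_part p q <= p)%O.
Proof. by have := le_meet_part p q (meet_part p q); rewrite lexx => /esym/andP[]. Qed.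

Lemma meet_part_ler p q : (meet_part p q <= q)%O.
Proof. by have := le_meet_part p q (meet_part p q); rewrite lexx => /esym/andP[]. Qed.

Lemma meet_one_part p : (0 < n)%N -> meet_part (one_part n) p = p.
Proof.
move=> n0; apply/le_anti.
by rewrite meet_part_ler le_meet_part lexx le_one_part.
Qed.

(** The blocks of the meet are the nonempty intersections of a block of [p]
    and a block of [q], each arising once; the condition on [g set0] makes the
    empty intersections harmless. *)
Lemma prod_meet_part (R : comPzRingType) p q (g : {set 'I_n} -> R) :
  g set0 = 1 ->
  \prod_(H in blocks (meet_part p q)) g H =
  \prod_(F in blocks p) \prod_(G in blocks q) g (F :&: G).
Proof.
move=> g0; rewrite [RHS]pair_big.
pose cap (u : {set 'I_n} * {set 'I_n}) := u.1 :&: u.2.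
pose D := [set u | (u.1 \in blocks p) && (u.2 \in blocks q) & cap u != set0].
have capP u i : u \in D -> i \in cap u -> u = (pblock p i, pblock q i).
  rewrite !inE; case: u => F G /= /andP[/andP[pF qG] _] /andP[Fi Gi].
  by congr pair; apply/esym/eqP; rewrite mem_partE.
have -> : blocks (meet_part p q) = cap @: D :> {set _}.
  apply/setP => H; apply/idP/imsetP => [/blockP[i ->]|[u uD ->]].
    exists (pblock p i, pblock q i); last by rewrite pblock_meet.
    rewrite inE !pblock_part /=; apply/set0Pn; exists i.
    by rewrite inE !mem_pblock_part.
  have /set0Pn[i ui] : cap u != set0 by move: uD; rewrite inE => /andP[].
  by rewrite (capP _ _ uD ui) /cap -pblock_meet pblock_part.
rewrite big_imset /=; last first.
  move=> u v uD vD uv.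
  have /set0Pn[i ui] : cap u != set0 by move: uD; rewrite inE => /andP[].
  by rewrite (capP _ _ uD ui) (capP _ i vD) // -uv.
rewrite [RHS](bigID (fun u => cap u != set0)) /= [X in _ * X]big1 ?mulr1.
  by apply: eq_bigl => u; rewrite inE.
by move=> u /andP[_]; rewrite negbK => /eqP; rewrite /cap => ->.
Qed.

(** Sending a block of [p] to the block of [q] that contains it is surjective;
    were it injective, [p] and [q] would be equal. *)
Lemma card_part_lt p q : (p < q)%O -> (#|blocks q| < #|blocks p|)%N.
Proof.
rewrite lt_neqAle => /andP[npq /part_leP pq].
pose up F := odflt set0 [pick G in blocks q | F \subset G].
have upE i : up (pblock p i) = pblock q i.
  rewrite /up; case: pickP => [G /andP[qG pG]|/(_ (pblock q i))] /=.
    by apply/esym/eqP; rewrite mem_partE // (subsetP pG) ?mem_pblock_part.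
  by rewrite pblock_part pq.
have -> : blocks q = up @: blocks p.
  apply/setP => G; apply/idP/imsetP => [/blockP[i ->]|[F /blockP[i ->] ->]].
    by exists (pblock p i); rewrite ?pblock_part.
  by rewrite upE pblock_part.
rewrite ltn_neqAle leq_imset_card andbT; apply: contra npq => /imset_injP up_inj.
rewrite eq_le; apply/andP; split; apply/part_leP => // i.
apply/subsetP => j qj; rewrite -(eq_pblock _ (part_trivIset p)) ?mem_cover_part //.
apply/eqP; apply: up_inj; rewrite ?pblock_part // !upE.
by apply/eqP; rewrite eq_pblock ?part_trivIset ?mem_cover_part.
Qed.

End Meet.

(** * Products of marginals of finite mixtures *)

Section Mixtures.
Variables (R : realType) (n : nat) (X : 'I_n -> choiceType).
Local Notation XX := (forall i, X i).
Implicit Types (P : set XX -> R) (F G : {set 'I_n}) (z : XX) (sigma pi : part n).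

Definition mixture (Y : Type) (I : finType) (c : I -> R) (x : I -> Y) :
    set Y -> R := fun A => \sum_k c k * \1_A (x k).

(** This is the marginal mass of the projection of [z] to [F], but on the whole
    space, which avoids the dependent types of the partial products. *)
Definition agree P F z : R := P [set y | forall i, i \in F -> y i = z i]%classic.

Lemma marginal_agree P F z : marginal P F [set restr F z]%classic = agree P F z.
Proof.
rewrite /marginal /agree; congr P; apply/seteqP; split=> y /= h.
  by move=> i Fi; have /(congr1 (fun u => u (exist _ i Fi))) := h.
by apply: functional_extensionality_dep => -[i Fi]; exact: h.
Qed.

(** A mixture of Dirac masses is recovered from its values on points: the
    support is contained in the range of [x], so the sum is finite. *)
Lemma mixture_fsbig (Y : choiceType) (I : finType) (c : I -> R) (x : I -> Y)
    (A : set Y) :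
  \sum_(z \in A) mixture c x [set z]%classic = mixture c x A.
Proof.
pose r := [seq z <- undup (codom x) | z \in A].
have ur : uniq r by rewrite filter_uniq ?undup_uniq.
rewrite (fsbigE r) //; first last.
- move=> z Az zr; rewrite /mixture big1 // => k _; rewrite indicE.
  have [/set_mem/= xk|] := boolP (x k \in _); last by rewrite mulr0.
  by move: zr; rewrite mem_filter mem_undup -xk codom_f mem_set // xk.
- by move=> z /=; rewrite mem_filter => /andP[/set_mem].
rewrite /mixture exchange_big /=; apply: eq_bigr => k _.
rewrite -mulr_sumr; congr (_ * _).
have [xA|xA] := boolP (x k \in A).
  rewrite big_mkcond (bigD1_seq (x k)) //=; last first.
    by rewrite mem_filter xA mem_undup codom_f.
  rewrite !indicE xA mem_set // big1 ?addr0 // => z zxk; rewrite indicE.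
  case: ifP => // _.
  by have [/set_mem/= xz|//] := boolP (x k \in _); rewrite xz eqxx in zxk.
rewrite indicE (negbTE xA) big1 // => z zA; rewrite indicE.
by have [/set_mem/= xz|//] := boolP (x k \in _); rewrite xz zA in xA.
Qed.

Lemma agree_mixture (I : finType) (c : I -> R) (x : I -> XX) F z :
  agree (mixture c x) F z = \sum_k c k * \prod_(i in F) (x k i == z i)%:R.
Proof.
apply: eq_bigr => k _; congr (_ * _); rewrite indicE.
have [/set_mem/= xz|xz] := boolP (_ \in _).
  by rewrite big1 // => i Fi; rewrite xz ?eqxx.
have /existsP[i] : [exists i, (i \in F) && (x k i != z i)].
  apply: contraR xz; rewrite negb_exists => /forallP xz; apply/mem_set => i Fi.
  by apply/eqP; move: (xz i); rewrite Fi negbK.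
by move=> /andP[Fi /negbTE xzi]; rewrite (bigD1 i) //= xzi mul0r.
Qed.

Section Product.
Variables (I : finType) (c : I -> R) (x : I -> XX).
Hypothesis c1 : \sum_k c k = 1.

(** The law of independent draws from [c], one for each subset of ['I_n]. Only the
    draws for the blocks of a partition matter, but indexing by all subsets
    gives every partition the same sample space. *)
Definition resample_weight (u : {ffun {set 'I_n} -> I}) : R := \prod_F c (u F).

Definition resample_point sigma (u : {ffun {set 'I_n} -> I}) : XX :=
  fun i => x (u (pblock sigma i)) i.

(** Independence: the conditions on the coordinates in [G] split according to the
    blocks of [sigma], and draws for distinct blocks are independent. *)
Lemma agree_resample sigma G z :
  agree (mixture resample_weight (resample_point sigma)) G z =
  \prod_(F in blocks sigma) agree (mixture c x) (G :&: F) z.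
Proof.
(* One factor for each independent draw; the draws for the sets [F] that are
   not blocks are unconstrained and contribute the total mass 1. *)
transitivity (\prod_F \sum_k
    (c k * \prod_(i in G | pblock sigma i == F) (x k i == z i)%:R)).
  rewrite bigA_distr_bigA agree_mixture; apply: eq_bigr => u _.
  rewrite big_split /=; congr (_ * _).
  rewrite (partition_big (pblock sigma) predT) //=.
  by apply: eq_bigr => F _; apply: eq_bigr => i /andP[_ /eqP<-].
rewrite (bigID (fun F => F \in blocks sigma)) /= [X in _ * X]big1 ?mulr1.
  apply: eq_bigr => F sF; rewrite agree_mixture; apply: eq_bigr => k _.
  by congr (_ * _); apply: eq_bigl => i; rewrite inE mem_partE.
move=> F nsF; rewrite -[RHS]c1; apply: eq_bigr => k _; rewrite big_pred0 ?mulr1 // => i.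
apply: contraNF nsF => /andP[_ /eqP<-]; exact: pblock_part.
Qed.

Lemma agree_setT (m : set XX -> R) z : agree m [set: 'I_n] z = m [set z]%classic.
Proof.
congr m; apply/seteqP; split=> [y /= yz|y /= -> //].
by apply: functional_extensionality_dep => i; apply: yz; rewrite inE.
Qed.

Lemma product_mixture sigma :
  product_of_marginals sigma (mixture c x) =
  mixture resample_weight (resample_point sigma).
Proof.
apply/funext => A; rewrite -mixture_fsbig; apply: eq_fsbigr => z _.
rewrite -agree_setT agree_resample; apply: eq_bigr => F _.
by rewrite marginal_agree setTI.
Qed.

End Product.

(** By [agree_resample], the mass that [P_sigma] gives to agreement on [F]
    factors over the intersections of [F] with the blocks of [sigma], and these,
    for [F] a block of [pi], are the blocks of the meet. *)
Lemma product_product (I : finType) (c : I -> R) (x : I -> XX) sigma pi :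
  \sum_k c k = 1 ->
  product_of_marginals pi (product_of_marginals sigma (mixture c x)) =
  product_of_marginals (meet_part pi sigma) (mixture c x).
Proof.
move=> c1; apply/funext => A; apply: eq_fsbigr => z _.
under eq_bigr do rewrite marginal_agree product_mixture // agree_resample //.
under [RHS]eq_bigr do rewrite marginal_agree.
rewrite (prod_meet_part pi sigma (g := fun F => agree (mixture c x) F z)) //.
by rewrite agree_mixture -[RHS]c1; apply: eq_bigr => k _; rewrite big_set0 mulr1.
Qed.

Lemma product_of_marginals_point (I : finType) (c : I -> R) (x : I -> XX) sigma z :
  product_of_marginals sigma (mixture c x) [set z]%classic =
  \prod_(F in blocks sigma) agree (mixture c x) F z.
Proof.
by rewrite /product_of_marginals fsbig_set1; under eq_bigr do rewrite marginal_agree.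
Qed.

Lemma mixture_probability (I : finType) (c : I -> R) (x : I -> XX) :
  (forall k, 0 <= c k) -> \sum_k c k = 1 -> discrete_probability (mixture c x).
Proof.
move=> c0 c1; split.
- exists #|I|, (c \o enum_val), (x \o enum_val) => A.
  by rewrite /mixture (big_enum_val (A := I)).
- by move=> A; apply: sumr_ge0 => k _; rewrite mulr_ge0 // indicE.
- by rewrite -[RHS]c1; apply: eq_bigr => k _; rewrite indicT mulr1.
Qed.

Lemma discrete_probability_mixture P : discrete_probability P ->
  exists k (c : 'I_k -> R) (x : 'I_k -> XX), \sum_i c i = 1 /\ P = mixture c x.
Proof.
move=> [[k [c [x PE]]] _ PT]; exists k, c, x; split; last exact/funext.
by rewrite -PT PE; apply: eq_bigr => i _; rewrite indicT mulr1.
Qed.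

End Mixtures.

(** * A diagonal measure on which the interaction is nonzero *)

Section Diagonal.
Variables (R : realType) (n : nat) (X : 'I_n -> choiceType).
Variables (e : forall i, 'I_n -> X i) (sigma : part n) (p : 'I_n -> R) (t : R).
Hypothesis e_inj : forall i, injective (e i).

Definition diag (k i : 'I_n) : X i := e i k.

Definition block_repr (i : 'I_n) : 'I_n := odflt i [pick j in pblock sigma i].

Lemma block_repr_mem i : block_repr i \in pblock sigma i.
Proof. by rewrite /block_repr; case: pickP => // _; exact: mem_pblock_part. Qed.

Lemma block_repr_eq i j : j \in pblock sigma i -> block_repr j = block_repr i.
Proof.
move=> ij; rewrite /block_repr (same_pblock (part_trivIset sigma) ij).
by case: pickP => // /(_ i); rewrite mem_pblock_part.
Qed.

(** On the diagonal, agreeing with the given point on a block of [tau] pins the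
    index down to the representative of the block of [sigma] around it. *)
Lemma product_diag tau : (forall i, p (block_repr i) = t) -> (tau <= sigma)%O ->
  product_of_marginals tau (mixture p diag)
    [set (fun i => e i (block_repr i))]%classic = t ^+ #|blocks tau|.
Proof.
move=> pt /part_leP ts; rewrite product_of_marginals_point -prodr_const.
apply: eq_bigr => F /blockP[i0 ->]; rewrite agree_mixture (bigD1 (block_repr i0)) //=.
rewrite pt big1 ?mulr1; last first.
  by move=> i /(subsetP (ts _)) /block_repr_eq ->; rewrite eqxx.
rewrite big1 ?addr0 // => k nk; rewrite (bigD1 i0) ?mem_pblock_part //=.
by rewrite (inj_eq (@e_inj i0)) (negbTE nk) mul0r mulr0.
Qed.

End Diagonal.

(** A surjective choice of representatives is injective, so that the blocks of
    [sigma] are singletons. *)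
Lemma block_repr_surj_le n (sigma pi : part n) :
  (forall k, exists i, block_repr sigma i = k) -> (sigma <= pi)%O.
Proof.
move=> rS; have r_inj : injective (block_repr sigma).
  apply/injectiveP/card_uniqP; rewrite size_map -cardE.
  apply: eq_card => k; rewrite inE; have [i <-] := rS k; exact: codom_f.
apply/part_leP => i; apply/subsetP => j /block_repr_eq/r_inj ->.
exact: mem_pblock_part.
Qed.

Lemma embeddings n (X : 'I_n -> choiceType) :
  (forall i : 'I_n, (`I_n #<= [set: X i])%classic%card) ->
  exists e : forall i, 'I_n -> X i, forall i, injective (e i).
Proof.
move=> hX; have he i : exists f : 'I_n -> X i, injective f.
  have [f] := card_leP (hX i).
  have I_n (k : 'I_n) : val k \in `I_n%classic by apply/mem_set; exact: ltn_ord.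
  pose u k : classical_sets.set_type `I_n%classic := @exist nat _ (val k) (I_n k).
  exists (fun k => val (f (u k))) => k l /val_inj fkl.
  have kl := congr1 (@proj1_sig _ _) ('inj_f (mem_set I) (mem_set I) fkl).
  apply: val_inj; exact: kl.
pose e i := projT1 (cid (he i)); exists e => i; exact: projT2 (cid (he i)).
Qed.

Section Converse.
Variables (R : realType) (n : nat) (X : 'I_n -> choiceType) (T : {set part n}).
Variable sigma : part n.
Hypotheses (n0 : (0 < n)%N) (T1 : one_part n \in T).
Hypothesis sigma_max : forall pi, pi \in T -> (sigma <= pi)%O -> pi = one_part n.

(** Bounds the coefficients of all the terms other than the one of [sigma]. *)
Definition mobius_mass : R :=
  \sum_(pi in T | pi != one_part n) `|(mobius T pi (one_part n))%:~R|.

(** The top contributes [t ^+ #|sigma|]; every other [pi] meets [sigma] strictly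
    below [sigma], hence in more blocks, and contributes a higher power. *)
Lemma mobius_sum_neq0 (t : R) : 0 < t -> t <= 1 -> mobius_mass * t < 1 ->
  \sum_(pi in T) (mobius T pi (one_part n))%:~R *
                 t ^+ #|blocks (meet_part pi sigma)| != 0.
Proof.
move=> t0 t1 Ct; rewrite (bigD1 (one_part n)) // mobius_refl // mul1r meet_one_part //.
set S := \sum_(pi in T | _) _; set s := #|blocks sigma|.
have leS : `|S| <= mobius_mass * t ^+ s.+1.
  rewrite mulr_suml; apply: le_trans (ler_norm_sum _ _ _) _.
  apply: ler_sum => pi /andP[piT pi1]; rewrite normrM ler_wpM2l //.
  rewrite ger0_norm ?exprn_ge0 ?(ltW t0) //; apply: ler_wiXn2l; rewrite ?(ltW t0) //.
  apply: card_part_lt; rewrite lt_neqAle meet_part_ler andbT.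
  apply: contra pi1 => /eqP m; apply/eqP/sigma_max => //.
  by rewrite -[leLHS]m meet_part_lel.
apply: contraTneq leS => /eqP; rewrite addr_eq0 -ltNge => /eqP tsE.
rewrite -normrN -tsE ger0_norm ?exprn_ge0 ?(ltW t0) // exprS mulrA.
by rewrite -[ltRHS]mul1r ltr_pM2r // exprn_gt0.
Qed.

Lemma interaction_neq0 : (forall i : 'I_n, (`I_n #<= [set: X i])%classic%card) ->
  exists2 P : set (forall i, X i) -> R, discrete_probability P &
  exists A, interaction T (product_of_marginals sigma P) A != 0.
Proof.
move=> /embeddings[e e_inj].
have C0 : 0 <= mobius_mass by apply: sumr_ge0.
(* [k0] takes the mass left over by the blocks. If every index represents a
   block then [sigma] is the bottom, the top is the only element of [T] and
   nothing is left over. *)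
have [k0 k0P] : exists k0, (forall i, block_repr sigma i != k0) \/ mobius_mass = 0.
  case: (pickP [pred k | k \notin codom (block_repr sigma)]) => [k0 /= k0P|nok].
    exists k0; left => i; apply: contraNneq k0P => <-; exact: codom_f.
  exists (Ordinal n0); right; rewrite /mobius_mass big_pred0 // => pi.
  apply/negP => /andP[piT /eqP[]]; apply: sigma_max => //.
  apply: block_repr_surj_le => k; have /negbFE/codomP[i ->] := nok k.
  by exists i.
have n0R : 1 <= n%:R :> R by rewrite ler1n.
have nC0 : 0 < n%:R + mobius_mass by lra.
(* With this value, giving [t] to each index and [mobius_mass * t] more to
   [k0] makes the total mass 1, while [mobius_mass * t < 1]. *)
pose t : R := (n%:R + mobius_mass)^-1.
have t0 : 0 < t by rewrite invr_gt0.
pose p k : R := t * (1 + mobius_mass * (k == k0)%:R).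
have p_ge0 k : 0 <= p k.
  by rewrite mulr_ge0 ?(ltW t0) // addr_ge0 // mulr_ge0.
have p_sum : \sum_k p k = 1.
  rewrite -mulr_sumr big_split /= sumr_const card_ord -mulr_sumr.
  rewrite (bigD1 k0) //= eqxx big1 ?addr0 ?mulr1; last by move=> k /negbTE->.
  by rewrite mulVf // gt_eqF.
have p_repr i : p (block_repr sigma i) = t.
  case: k0P => [/(_ i)/negbTE k0i|C]; first by rewrite /p k0i mulr0 addr0 mulr1.
  by rewrite /p C mul0r addr0 mulr1.
exists (mixture p (diag e)); first exact: mixture_probability.
exists [set (fun i => e i (block_repr sigma i))]%classic.
rewrite /interaction; under eq_bigr => pi _.
  rewrite product_product // (product_diag e_inj p_repr) ?meet_part_ler //.
  over.
apply: mobius_sum_neq0 => //.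
  by rewrite invf_le1 //; lra.
by rewrite ltr_pdivrMr // mul1r; lra.
Qed.

End Converse.

Theorem corollary3p6 (R : realType) (n : nat) (hn : (0 < n)%N)
    (X : 'I_n -> choiceType) (T : {set part n}) (hT : lower_set T)
    (hX : forall i : 'I_n, (`I_n #<= [set: X i])%classic%card)
    (sigma : part n) :
  (forall P : set (forall i : 'I_n, X i) -> R, discrete_probability P ->
     forall A : set (forall i : 'I_n, X i),
       interaction T (product_of_marginals sigma P) A = 0)
  <-> sigma \in T :\ one_part n.
Proof.
have [_ T1 T_down] := hT; split=> [vanish|sT P /discrete_probability_mixture].
  apply: contrapT => nsT.
  have sigma_max pi : pi \in T -> (sigma <= pi)%O -> pi = one_part n.
    move=> piT lepi; apply: contrapT => /eqP pi1; apply: nsT.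
    have sT : sigma \in T by apply: (T_down pi) => //; rewrite in_setD1 pi1.
    rewrite in_setD1 sT andbT; apply: contra pi1 => /eqP s1.
    by rewrite eq_le le_one_part //= -s1.
  have [P Pprob [A /eqP[]]] := interaction_neq0 R hn T1 sigma_max hX.
  exact: vanish.
move=> [k [c [x [c1 ->]]]] A; rewrite /interaction.
under eq_bigr do rewrite product_product //.
have /setD1P[s1 _] := sT.
apply: (mobius_sum_meet (s := sigma) (m := fun pi => meet_part pi sigma)
  (fun tau => product_of_marginals tau (mixture c x) A)) => //.
- by rewrite lt_neqAle s1 le_one_part.
- by move=> tau; exact: T_down sT.
- by move=> pi tau; exact: le_meet_part.
Qed.
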